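(* Suppose $K_{ff}=K_{ff}^{T}$ is invertible. Then for every admissible $k$, $$\dim\mathcal{Y}=d\qquad\text{and}\qquad d-\operatorname{rank}\frac{\partial R}{\partial k}=\dim\Bigl(\mathcal{Y}\cap K_{ff}V^{\perp}K_{ff}\Bigr),$$ where $d=m_Tm_S-\tfrac12p(p-1)$ and $K_{ff}V^{\perp}K_{ff}=\{K_{ff}MK_{ff}:M\in V^{\perp}\}$.
   Context: Network: $N$ point nodes at positions $x_i\in\mathbb{R}^2$ are joined by $n_b$ bonds. For a bond $b=(i,j)$ of length $L_b=|x_j-x_i|>0$ let $\hat n_b=(x_j-x_i)/L_b$ and let $\hat t_b$ be $\hat n_b$ rotated by $+90^\circ$. The vector $q_b\in\mathbb{R}^{2N}$ carries $-\hat n_b$ at node $i$, $+\hat n_b$ at node $j$, zeros elsewhere; $s_b$ is the same with $\hat t_b$. For stiffnesses $k=(k_b)$ and odd couplings $a=(a_b)$ (fixed), $K=\sum_b(k_bq_b+a_bs_b)q_b^{T}$. Three degrees of freedom are pinned to remove the planar rigid-body modes, $K_{ff}$ is the restriction of $K$ to the remaining $n_{\mathrm{free}}=2N-3$ free ones and $C=K_{ff}^{-1}$. $k$ is admissible if all $k_b>0$ and $K_{ff}$ is invertible. Below $q_b$ denotes its restriction to the free degrees of freedom. Response block: $S$ (driven) and $T$ (read) are sets of free degrees of freedom, $|S|=m_S$, $|T|=m_T$, $P=T\cap S$, $p=|P|$, $R(k)=C[T,S]$. $\tau,\sigma$ give the positions of elements of $P$ inside $T$ and $S$, and $\mathcal{S}_P=\{A\in\mathbb{R}^{m_T\times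 m_S}:A_{\tau(r)\sigma(c)}=A_{\tau(c)\sigma(r)}\ \forall r,c\in P\}$. $\operatorname{Sym}$ is the space of symmetric $n_{\mathrm{free}}\times n_{\mathrm{free}}$ matrices with the trace inner product; $V=\operatorname{span}\{q_bq_b^{T}\}_b\subseteq\operatorname{Sym}$; $V^{\perp}=\{M\in\operatorname{Sym}:q_b^{T}Mq_b=0\ \forall b\}$. For $Y\in\mathbb{R}^{m_T\times m_S}$, $\hat Y\in\mathbb{R}^{n_{\mathrm{free}}\times n_{\mathrm{free}}}$ is $Y$ placed in rows $T$ and columns $S$ with zeros elsewhere, and $\mathcal{Y}=\{\tfrac12(\hat Y+\hat Y^{T}):Y\in\mathcal{S}_P\}\subseteq\operatorname{Sym}$. *)

(* Defs.v *)
From HB Require Import structures.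
From mathcomp Require Import all_boot all_order all_algebra.
From mathcomp Require Import all_classical all_reals all_analysis.

Set Implicit Arguments.
Unset Strict Implicit.
Unset Printing Implicit Defensive.

Import Order.TTheory GRing.Theory Num.Theory.
Import numFieldNormedType.Exports.

Local Open Scope ring_scope.

Section Plane.
Variable R : realType.

(* Euclidean length; the library norm on ['rV[R]_2] is the sup norm. *)
Definition enorm (u : 'rV[R]_2) : R := Num.sqrt (u 0 0 ^+ 2 + u 0 1 ^+ 2).

Definition rot90 (u : 'rV[R]_2) : 'rV[R]_2 :=
  \row_c (if c == 0 then - u 0 1 else u 0 0).

(* Infinitesimal planar rigid motion of nodes at positions [row i x]:
   translation [t] plus rotation at rate [w] about the origin. *)
Definition rigid_motion N (x : 'M[R]_(N, 2)) (t : 'rV[R]_2) (w : R) :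
    'M[R]_(N, 2) :=
  \matrix_i (t + w *: rot90 (row i x)).

End Plane.

(* Vectors of R^(2N) are the [mxvec] of N x 2 arrays: coordinate [c] of node
   [i] is the degree of freedom [mxvec_index i c : 'I_(N * 2)]. *)
Record network (R : realType) (N nb : nat) := Network {
  pos : 'M[R]_(N, 2);
  src : 'I_nb -> 'I_N;
  dst : 'I_nb -> 'I_N;
  pinned : {set 'I_(N * 2)};
  bond_length_gt0 :
    forall b, 0 < enorm (row (dst b) pos - row (src b) pos);
  card_pinned : #|pinned| = 3%N;
  (* no nonzero rigid-body mode vanishes on the pinned degrees of freedom *)
  pinned_rigid : forall (t : 'rV[R]_2) (w : R),
    (forall e, e \in pinned -> mxvec (rigid_motion pos t w) 0 e = 0) ->
    rigid_motion pos t w = 0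
}.

Section Network.
Variables (R : realType) (N nb : nat) (G : network R N nb).

Definition bond_length (b : 'I_nb) : R :=
  enorm (row (dst G b) (pos G) - row (src G b) (pos G)).

Definition nhat (b : 'I_nb) : 'rV[R]_2 :=
  (bond_length b)^-1 *: (row (dst G b) (pos G) - row (src G b) (pos G)).

Definition that (b : 'I_nb) : 'rV[R]_2 := rot90 (nhat b).

(* [- u] at node [src b], [+ u] at node [dst b], zero elsewhere; the two
   nodes differ since the bond has positive length. *)
Definition bond_vector (b : 'I_nb) (u : 'rV[R]_2) : 'cV[R]_(N * 2) :=
  (mxvec (\matrix_i ((i == dst G b)%:R *: u - (i == src G b)%:R *: u)))^T.

Definition qfull (b : 'I_nb) : 'cV[R]_(N * 2) := bond_vector b (nhat b).

Definition sfull (b : 'I_nb) : 'cV[R]_(N * 2) := bond_vector b (that b).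

Definition Kfull (a k : 'rV[R]_nb) : 'M[R]_(N * 2) :=
  \sum_b (k 0 b *: qfull b + a 0 b *: sfull b) *m (qfull b)^T.

Definition nfree : nat := #|~: pinned G|.

Lemma nfreeE : nfree = (2 * N - 3)%N.
Proof. by rewrite /nfree cardsCs finset.setCK card_ord card_pinned mulnC. Qed.

Definition free_dof (i : 'I_nfree) : 'I_(N * 2) := enum_val i.

Definition Kff (a k : 'rV[R]_nb) : 'M[R]_nfree :=
  mxsub free_dof free_dof (Kfull a k).

Definition compliance (a k : 'rV[R]_nb) : 'M[R]_nfree := invmx (Kff a k).

Definition admissible (a k : 'rV[R]_nb) : Prop :=
  (forall b, 0 < k 0 b) /\ Kff a k \in unitmx.

Definition q (b : 'I_nb) : 'cV[R]_nfree := rowsub free_dof (qfull b).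

Definition response (a : 'rV[R]_nb) (T S : {set 'I_nfree}) (k : 'rV[R]_nb) :
    'M[R]_(#|T|, #|S|) :=
  mxsub (fun t : 'I_(#|T|) => enum_val t) (fun s : 'I_(#|S|) => enum_val s)
    (compliance a k).

(* Matrix of the partial derivatives of the entries of the response; rows are
   indexed by bonds, columns by the entries (via [mxvec]). *)
Definition dresponse (a : 'rV[R]_nb) (T S : {set 'I_nfree}) (k : 'rV[R]_nb) :
    'M[R]_(nb, #|T| * #|S|) :=
  'J (fun k' : 'rV[R]_nb => mxvec (response a T S k')) k.

End Network.

Section Subspaces.
Variables (R : realType) (n : nat).

Definition skew_part (M : 'M[R]_n) : 'M[R]_n := M - M^T.

Fact skew_part_linear : linear skew_part.
Proof.
by move=> c A B; rewrite /skew_part linearP /= scalerBr opprD addrACA.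
Qed.
HB.instance Definition _ :=
  GRing.isLinear.Build R 'M[R]_n 'M[R]_n _ skew_part skew_part_linear.

Definition Sym : {vspace 'M[R]_n} := lker (linfun skew_part).

Lemma mem_Sym M : (M \in Sym) = (M^T == M).
Proof. by rewrite memv_ker lfunE /= subr_eq0 eq_sym. Qed.

Definition quad_form (v : 'cV[R]_n) (M : 'M[R]_n) : 'M[R]_1 := v^T *m M *m v.

Fact quad_form_linear v : linear (quad_form v).
Proof.
by move=> c A B; rewrite /quad_form mulmxDr mulmxDl -scalemxAr -scalemxAl.
Qed.
HB.instance Definition _ v :=
  GRing.isLinear.Build R 'M[R]_n 'M[R]_1 _ (quad_form v) (quad_form_linear v).

Section Bonds.
Variables (nb : nat) (v : 'I_nb -> 'cV[R]_n).

Definition rank1_span : {vspace 'M[R]_n} :=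
  <<[seq v b *m (v b)^T | b <- enum 'I_nb]>>%VS.

Definition rank1_perp : {vspace 'M[R]_n} :=
  (Sym :&: \bigcap_b lker (linfun (quad_form (v b))))%VS.

Lemma mem_rank1_perp M :
  reflect (M^T = M /\ forall b, (v b)^T *m M *m v b = 0)
          (M \in rank1_perp).
Proof.
rewrite memv_cap mem_Sym; apply: (iffP andP) => -[/eqP MT Mv]; split=> //.
- move=> b; move: Mv; rewrite memvE => /subv_bigcapP/(_ b isT).
  by rewrite -memvE memv_ker lfunE => /eqP.
- rewrite memvE; apply/subv_bigcapP => b _.
  by rewrite -memvE memv_ker lfunE /=; apply/eqP/Mv.
Qed.

(* The trace-orthogonal complement of the span inside [Sym]. *)
Lemma rank1_perpP M :
  M \in rank1_perp <->
  M \in Sym /\ forall W, W \in rank1_span -> \tr (M *m W) = 0.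
Proof.
have trE b : \tr (M *m (v b *m (v b)^T)) = ((v b)^T *m M *m v b) 0 0.
  by rewrite mulmxA mxtrace_mulC mulmxA /mxtrace big_ord1.
rewrite mem_Sym; split.
- case/mem_rank1_perp=> MT Mv; split; first exact/eqP.
  move=> W /coord_span ->; rewrite mulmx_sumr raddf_sum big1 // => i _.
  have /mapP[b _ Eb] : [seq v b *m (v b)^T | b <- enum 'I_nb]`_i
      \in [seq v b *m (v b)^T | b <- enum 'I_nb].
    by apply: mem_nth; rewrite size_map -cardE.
  by rewrite -scalemxAr /= mxtraceZ Eb trE Mv mxE mulr0.
- case=> /eqP MT Mv; apply/mem_rank1_perp; split=> // b.
  apply/matrixP => i j; rewrite !ord1 -trE Mv ?mxE //.
  by apply: memv_span; apply: map_f; rewrite mem_enum.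
Qed.

End Bonds.

Definition congr_by (K M : 'M[R]_n) : 'M[R]_n := K *m M *m K.

Fact congr_by_linear K : linear (congr_by K).
Proof.
by move=> c A B; rewrite /congr_by mulmxDr mulmxDl -scalemxAr -scalemxAl.
Qed.
HB.instance Definition _ K :=
  GRing.isLinear.Build R 'M[R]_n 'M[R]_n _ (congr_by K) (congr_by_linear K).

Definition congr_space (K : 'M[R]_n) (U : {vspace 'M[R]_n}) :
    {vspace 'M[R]_n} :=
  (linfun (congr_by K) @: U)%VS.

Lemma mem_congr_space K U M :
  M \in congr_space K U <-> exists2 W, W \in U & M = K *m W *m K.
Proof.
split; first by case/memv_imgP=> W WU ->; exists W; rewrite ?lfunE.
by case=> W WU ->; apply/memv_imgP; exists W; rewrite ?lfunE.
Qed.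

Section Block.
Variables T S : {set 'I_n}.

(* [tau r] and [sigma r] are the positions, in the enumerations of [T] and
   [S], of the [r]-th element of [T :&: S]. *)
Definition tau (r : 'I_(#|T :&: S|)) : 'I_(#|T|) :=
  enum_rank_in (fintype.subsetP (subsetIl T S) _ (enum_valP r)) (enum_val r).

Definition sigma (r : 'I_(#|T :&: S|)) : 'I_(#|S|) :=
  enum_rank_in (fintype.subsetP (subsetIr T S) _ (enum_valP r)) (enum_val r).

Lemma enum_val_tau r : enum_val (tau r) = enum_val r.
Proof. by rewrite enum_rankK_in // (fintype.subsetP (subsetIl T S)) ?enum_valP. Qed.

Lemma enum_val_sigma r : enum_val (sigma r) = enum_val r.
Proof. by rewrite enum_rankK_in // (fintype.subsetP (subsetIr T S)) ?enum_valP. Qed.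

Definition block_skew (A : 'M[R]_(#|T|, #|S|)) : 'M[R]_(#|T :&: S|) :=
  \matrix_(r, c) (A (tau r) (sigma c) - A (tau c) (sigma r)).

Fact block_skew_linear : linear block_skew.
Proof.
by move=> c A B; apply/matrixP => i j; rewrite !mxE mulrBr opprD addrACA.
Qed.
HB.instance Definition _ :=
  GRing.isLinear.Build R _ _ _ block_skew block_skew_linear.

Definition SP : {vspace 'M[R]_(#|T|, #|S|)} := lker (linfun block_skew).

Lemma mem_SP A :
  A \in SP <-> forall r c, A (tau r) (sigma c) = A (tau c) (sigma r).
Proof.
rewrite memv_ker lfunE /=; split=> [/eqP A0 r c | A0].
  by apply/eqP; rewrite -subr_eq0; move/matrixP/(_ r c): A0; rewrite !mxE => ->.
by apply/eqP/matrixP => r c; rewrite !mxE A0 subrr.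
Qed.

Definition embed (Y : 'M[R]_(#|T|, #|S|)) : 'M[R]_n :=
  \sum_t \sum_s Y t s *: delta_mx (enum_val t) (enum_val s).

Fact embed_linear : linear embed.
Proof.
move=> c A B; rewrite /embed scaler_sumr -big_split; apply: eq_bigr => t _ /=.
rewrite scaler_sumr -big_split; apply: eq_bigr => s _ /=.
by rewrite !mxE scalerDl scalerA.
Qed.
HB.instance Definition _ := GRing.isLinear.Build R _ _ _ embed embed_linear.

Lemma embedE Y t s : embed Y (enum_val t) (enum_val s) = Y t s.
Proof.
rewrite /embed summxE (bigD1 t) //= summxE (bigD1 s) //= !mxE !eqxx mulr1.
rewrite big1 ?addr0 => [|s' /negPf s's]; last first.
  by rewrite !mxE !(inj_eq enum_val_inj) (eq_sym s) s's andbF mulr0.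
rewrite big1 ?addr0 // => t' /negPf t't; rewrite summxE big1 // => s' _.
by rewrite !mxE !(inj_eq enum_val_inj) (eq_sym t) t't mulr0.
Qed.

Lemma embed_out Y i j : ~~ ((i \in T) && (j \in S)) -> embed Y i j = 0.
Proof.
move=> ijTS; rewrite /embed summxE big1 // => t _; rewrite summxE big1 // => s _.
rewrite !mxE; case: eqP => [Ei|_]; last by rewrite mulr0.
case: eqP => [Ej|_]; last by rewrite mulr0.
by move: ijTS; rewrite Ei Ej !enum_valP.
Qed.

Definition sym_embed (Y : 'M[R]_(#|T|, #|S|)) : 'M[R]_n :=
  2^-1 *: (embed Y + (embed Y)^T).

Fact sym_embed_linear : linear sym_embed.
Proof.
move=> c A B; rewrite /sym_embed !linearP /= scalerA [c * _]mulrC -scalerA.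
by rewrite -scalerDr [c *: (_ + _)]scalerDr addrACA.
Qed.
HB.instance Definition _ :=
  GRing.isLinear.Build R _ _ _ sym_embed sym_embed_linear.

Definition Yspace : {vspace 'M[R]_n} := (linfun sym_embed @: SP)%VS.

Lemma mem_Yspace M :
  M \in Yspace <->
  exists2 Y, Y \in SP & M = 2^-1 *: (embed Y + (embed Y)^T).
Proof.
split; first by case/memv_imgP=> Y YP ->; exists Y; rewrite ?lfunE.
by case=> Y YP ->; apply/memv_imgP; exists Y; rewrite ?lfunE.
Qed.

End Block.
End Subspaces.

Arguments Yspace R {n} T S.

(* Main.v *)
(* At the given [k] the derivative of [C = K_ff^-1] along [k_b] is
   [- C q_b q_b^T C]; since [C] is symmetric, row [b] of the Jacobian is, up to
   sign, the block of [w_b w_b^T] with [w_b = C q_b], hence lies in [S_P].  So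
   [d - rank] is the dimension of the [Y] in [S_P] orthogonal to all rows, i.e.
   with [w_b^T sym(Y) w_b = q_b^T C sym(Y) C q_b = 0] for every [b], i.e. with
   [C sym(Y) C] in [V^perp].  Finally [Y |-> sym(Y)] is injective on [S_P]. *)
From HB Require Import structures.
Require Import Defs.
From mathcomp Require Import all_boot all_order all_fingroup all_algebra.
From mathcomp Require Import all_classical all_reals all_analysis.

Set Implicit Arguments.
Unset Strict Implicit.
Unset Printing Implicit Defensive.

Import Order.TTheory GRing.Theory Num.Theory.
Import numFieldNormedType.Exports.

Local Open Scope ring_scope.

(** * Ranks over real fields and dimensions of images *)

(** If [u *m A *m A^T = 0], then the squares of the entries of [u *m A] sum to 0, so [u *m A = 0];
    hence the two left kernels agree. *)
Lemma mxrank_mul_trmx (F : realFieldType) m n (A : 'M[F]_(m, n)) :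
  \rank (A *m A^T) = \rank A.
Proof.
have sub_ker : (kermx (A *m A^T) <= kermx A)%MS.
  apply/rV_subP => u /sub_kermxP; rewrite mulmxA => uAA.
  apply/sub_kermxP/rowP => j; rewrite [RHS]mxE.
  have : ((u *m A) *m (u *m A)^T) 0 0 = 0.
    by rewrite trmx_mul mulmxA uAA mul0mx mxE.
  rewrite mxE (eq_bigr (fun i => (u *m A) 0 i ^+ 2)) => [sq0|i _]; last first.
    by rewrite [X in _ * X]mxE expr2.
  apply/eqP; rewrite -sqrf_eq0; apply/eqP; move: j isT.
  by apply: psumr_eq0P sq0 => i _; exact: sqr_ge0.
apply/eqP; rewrite eqn_leq mxrankM_maxl /=.
by have := mxrankS sub_ker; rewrite !mxrank_ker leq_sub2lE ?rank_leq_row.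
Qed.

(** Bridge from matrix rank to subspace dimension: replacing [A] by [row_base A] keeps the image and
    makes the map injective. *)
Lemma dim_limg_mulmxr (F : fieldType) m n (A : 'M[F]_(m, n)) :
  \dim (limg (linfun (mulmxr A : 'rV[F]_m -> 'rV[F]_n))) = \rank A.
Proof.
pose f := linfun (mulmxr A : 'rV[F]_m -> 'rV[F]_n).
pose g := linfun (mulmxr (row_base A) : 'rV[F]_(\rank A) -> 'rV[F]_n).
have -> : limg f = limg g.
  apply/vspaceP => w; apply/memv_imgP/memv_imgP => -[u _ ->].
    exists (u *m col_base A); rewrite ?memvf // !lfunE /=.
    by rewrite -mulmxA mulmx_base.
  have /row_fullP[B BA] := col_base_full A.
  exists (u *m B); rewrite ?memvf // !lfunE /=.
  rewrite -mulmxA -(congr1 (mulmx B) (mulmx_base A)).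
  by rewrite [B *m _]mulmxA BA mul1mx.
rewrite limg_dim_eq; first by rewrite dimvf dim_matrix; exact: mul1n.
apply/eqP; rewrite -subv0; apply/subvP => u.
rewrite memv_cap memv_ker lfunE /= memv0 => /andP[_ /eqP u0].
by apply/eqP/(row_free_inj (row_base_free A)); rewrite u0 mul0mx.
Qed.

(* Over a real field [J *m J^T] has the rank of [J], so [Y |-> mxvec Y *m J^T]
   already reaches its full rank on any subspace containing the rows of [J]. *)
Lemma dim_orthogonal_rows (F : realFieldType) r m n
    (U : {vspace 'M[F]_(m, n)}) (J : 'M[F]_(r, m * n)) :
  (forall i, vec_mx (row i J) \in U) ->
  (\dim (U :&: lker (linfun (mulmxr J^T \o mxvec))) + \rank J)%N = \dim U.
Proof.
move=> JU; set g := linfun _.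
rewrite -(limg_ker_dim g U); congr addn; apply/eqP; rewrite eqn_leq.
apply/andP; split.
  (* Lower bound on the image of [U]: each [u *m J] is a combination of rows of [J], so it comes
     from [U], and [g] sends it to [u *m J *m J^T]. *)
  rewrite -mxrank_mul_trmx -dim_limg_mulmxr; apply: dimvS.
  apply/subvP => _ /memv_imgP[u _ ->]; apply/memv_imgP.
  exists (vec_mx (u *m J)); last by rewrite !lfunE /= vec_mxK mulmxA.
  rewrite mulmx_sum_row linear_sum rpred_sum // => i _.
  rewrite (_ : _ (_ *: _) = u 0 i *: vec_mx (row i J)) ?rpredZ //.
  exact: linearZ.
rewrite -(mxrank_tr J) -dim_limg_mulmxr; apply: dimvS.
apply/subvP => _ /memv_imgP[u _ ->]; apply/memv_imgP.
by exists (mxvec u); rewrite ?memvf // !lfunE.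
Qed.

(** Grouping the pairs by their larger component [j] leaves [j] choices for the smaller one. *)
Lemma card_ltn_pairs p :
  #|[set x : 'I_p * 'I_p | (x.1 < x.2)%N]| = 'C(p, 2).
Proof.
rewrite -triangular_sum big_mkord -sum1dep_card.
rewrite (eq_bigl (fun x : 'I_p * 'I_p => true && (x.1 < x.2)%N)) //.
rewrite -(pair_big_dep xpredT (fun i j : 'I_p => (i < j)%N)
  (fun _ _ => 1%N)) /=.
rewrite (exchange_big_dep xpredT) //=; apply: eq_bigr => j _.
rewrite sum1dep_card -[RHS]card_ord.
pose w := widen_ord (ltnW (ltn_ord j)).
have w_inj : injective w by move=> x y /(congr1 val) /= /val_inj.
rewrite -(card_imset predT w_inj); apply: eq_card => i; rewrite inE.
apply/idP/imsetP => [ij | [l _ ->]]; last exact: (ltn_ord l).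
by exists (Ordinal ij) => //; apply: val_inj.
Qed.

(** * Dimension of the block space and its symmetrised embedding *)

Section Block.
Variables (R : realType) (n : nat) (T S : {set 'I_n}).

Lemma tau_inj : injective (tau (T := T) (S := S)).
Proof.
by move=> r c /(congr1 enum_val); rewrite !enum_val_tau => /enum_val_inj.
Qed.

Lemma sigma_inj : injective (sigma (T := T) (S := S)).
Proof.
by move=> r c /(congr1 enum_val); rewrite !enum_val_sigma => /enum_val_inj.
Qed.

(** The equations at [(r, c)] and [(c, r)] differ by a sign and the diagonal ones are void, so those
    with [r < c] suffice; they are independent because [f] is surjective. *)
Lemma dim_SP :
  (\dim (SP R T S) + 'C(#|T :&: S|, 2))%N = (#|T| * #|S|)%N.
Proof.
pose D := [set x : 'I_(#|T :&: S|) * 'I_(#|T :&: S|) | (x.1 < x.2)%N].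
pose up (B : 'M[R]_(#|T :&: S|)) : 'rV[R]_#|D| :=
  \row_l B (enum_val l).1 (enum_val l).2.
have up_lin : linear up by move=> c A B; apply/rowP => l; rewrite !mxE.
pose upL : {linear _ -> _} :=
  HB.pack up (GRing.isLinear.Build R _ _ _ up up_lin).
pose f := linfun (upL \o block_skew (R := R) (T := T) (S := S)).
have -> : SP R T S = lker f.
  apply/vspaceP => A; rewrite !memv_ker !lfunE /=.
  apply/eqP/eqP => [-> | /rowP A0]; first by apply: (linear0 upL).
  have ltA (r c : 'I_(#|T :&: S|)) : (r < c)%N -> block_skew A r c = 0.
    move=> rc; have rcD : (r, c) \in D by rewrite inE.
    have := A0 (enum_rank_in rcD (r, c)).
    by rewrite /= mxE [RHS]mxE enum_rankK_in.
  apply/matrixP => r c; rewrite [RHS]mxE.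
  have [/ltA //|cr|/val_inj ->] := ltngtP r c; last by rewrite mxE subrr.
  by move/ltA/eqP: cr; rewrite mxE -oppr_eq0 opprB mxE => /eqP.
have := limg_ker_dim f fullv; rewrite capfv dimvf dim_matrix; apply: etrans.
congr addn; rewrite -card_ltn_pairs -/D.
suff -> : limg f = fullv by rewrite dimvf dim_matrix [RHS]mul1n.
apply/vspaceP => w; rewrite memvf; apply/memv_imgP.
(* The position [(tau r, sigma c)] with [r < c] enters only the equation of [(r, c)]: its mirror
   image would need a pair of [D] in decreasing order. *)
exists (\sum_l w 0 l *: delta_mx (tau (enum_val l).1) (sigma (enum_val l).2)).
  exact: memvf.
rewrite linear_sum {1}[w]row_sum_delta; apply: eq_bigr => l _.
rewrite linearZ; congr (_ *: _); apply: etrans (esym (lfunE _ _)) => /=.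
have lt_D (i : 'I_#|D|) : ((enum_val i).1 < (enum_val i).2)%N.
  by have := enum_valP i; rewrite inE.
apply/rowP => i; rewrite !mxE eqxx /= !(inj_eq tau_inj) !(inj_eq sigma_inj).
rewrite -!xpair_eqE -!surjective_pairing (inj_eq enum_val_inj).
have -> : ((enum_val i).2, (enum_val i).1) == enum_val l = false.
  apply/negP => /eqP il; have := lt_D l; rewrite -il /=.
  by rewrite ltnNge ltnW.
by rewrite subr0.
Qed.

Lemma embed_sym (Y : 'M[R]_(#|T|, #|S|)) i j :
  Y \in SP R T S -> i \in T :&: S -> j \in T :&: S ->
  embed Y i j = embed Y j i.
Proof.
move=> /mem_SP YP iP jP.
have := YP (enum_rank_in iP i) (enum_rank_in jP j).
by rewrite -!embedE !enum_val_tau !enum_val_sigma !enum_rankK_in.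
Qed.

(** At position [(t, s)] the transposed term vanishes unless both indices lie in [T :&: S], where it
    equals [Y t s] by symmetry. The entry is thus [Y t s] or half of it. *)
Lemma sym_embed_eq0 (Y : 'M[R]_(#|T|, #|S|)) :
  Y \in SP R T S -> sym_embed Y = 0 -> Y = 0.
Proof.
move=> YP /matrixP Y0; apply/matrixP => t s; rewrite [RHS]mxE.
have := Y0 (enum_val t) (enum_val s); rewrite !mxE => /eqP.
rewrite mulf_eq0 invr_eq0 pnatr_eq0 /=.
have [/andP[sT tS] | out] :=
    boolP ((enum_val s \in T) && (enum_val t \in S)); last first.
  by rewrite [X in _ + X]embed_out // addr0 embedE => /eqP.
rewrite (@embed_sym _ (enum_val s)) ?inE ?enum_valP ?sT ?tS // embedE.
by rewrite -mulr2n mulrn_eq0 => /eqP.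
Qed.

Lemma dim_sym_embed (U : {vspace 'M[R]_(#|T|, #|S|)}) :
  (U <= SP R T S)%VS ->
  \dim (linfun (sym_embed (R := R) (T := T) (S := S)) @: U) = \dim U.
Proof.
move=> UP; apply: limg_dim_eq; apply/eqP; rewrite -subv0; apply/subvP => Y.
rewrite memv_cap memv_ker lfunE /= memv0 => /andP[YU /eqP Y0].
by apply/eqP/sym_embed_eq0 => //; apply: (subvP UP).
Qed.

(** Turns the quadratic form into the entrywise pairing of [Y] with the block of [w *m w^T]; a
    quadratic form does not see the transpose. *)
Lemma quad_sym_embed (w : 'cV[R]_n) (Y : 'M[R]_(#|T|, #|S|)) :
  (w^T *m sym_embed Y *m w) 0 0 =
    \sum_t \sum_s Y t s * (w (enum_val t) 0 * w (enum_val s) 0).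
Proof.
have embedw : (w^T *m embed Y *m w) 0 0 =
    \sum_t \sum_s Y t s * (w (enum_val t) 0 * w (enum_val s) 0).
  rewrite /embed mulmx_sumr mulmx_suml summxE; apply: eq_bigr => t _.
  rewrite mulmx_sumr mulmx_suml summxE; apply: eq_bigr => s _.
  rewrite -scalemxAr -scalemxAl mxE; congr (_ * _).
  rewrite -(mul_delta_mx (0 : 'I_1)) mulmxA -colE -mulmxA -rowE.
  by rewrite mxE big_ord1 !mxE.
have embedTw : (w^T *m (embed Y)^T *m w) 0 0 = (w^T *m embed Y *m w) 0 0.
  have -> : (w^T *m (embed Y)^T *m w) = (w^T *m embed Y *m w)^T.
    by rewrite !trmx_mul trmxK mulmxA.
  by rewrite mxE.
rewrite -embedw /sym_embed -scalemxAr -scalemxAl mulmxDr mulmxDl.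
rewrite mxE [X in _ * X]mxE embedTw -mulr2n -[X in _ * X]mulr_natr.
by rewrite mulrC mulfK // pnatr_eq0.
Qed.

(** The only candidate preimage of [M] is [invmx K *m M *m invmx K]; symmetry of [K] moves the
    inverses onto [q b]. *)
Lemma mem_congr_perp nb (q : 'I_nb -> 'cV[R]_n) (K M : 'M[R]_n) :
  K \in unitmx -> K^T = K -> M^T = M ->
  M \in congr_space K (rank1_perp q) <->
  forall b, ((invmx K *m q b)^T *m M *m (invmx K *m q b)) 0 0 = 0.
Proof.
move=> Ku KT MT.
have CT : (invmx K)^T = invmx K by rewrite trmx_inv KT.
have E b : (invmx K *m q b)^T *m M *m (invmx K *m q b) =
           (q b)^T *m (invmx K *m M *m invmx K) *m q b.
  by rewrite trmx_mul CT !mulmxA.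
rewrite mem_congr_space; split=> [[W /mem_rank1_perp[_ Wq] MW] b | Mq].
  have CMC : invmx K *m M *m invmx K = W.
    by rewrite MW !mulmxA mulVmx // mul1mx -mulmxA mulmxV // mulmx1.
  by rewrite E CMC Wq mxE.
exists (invmx K *m M *m invmx K).
  apply/mem_rank1_perp; split=> [|b].
    by rewrite !trmx_mul CT MT mulmxA.
  by rewrite -E; apply/matrixP => i j; rewrite !ord1 Mq mxE.
by rewrite !mulmxA mulmxV // mul1mx -mulmxA mulVmx // mulmx1.
Qed.

(** The algebraic core, with the calculus confined to the formula for [J]: the intersection is the
    injective image under [sym_embed] of the part of [SP] killed by all rows of [J]. *)
Lemma dim_Yspace_cap_congr nb (q : 'I_nb -> 'cV[R]_n) (K : 'M[R]_n)
    (J : 'M[R]_(nb, #|T| * #|S|)) :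
  K \in unitmx -> K^T = K ->
  (forall b t s, J b (mxvec_index t s) =
     - ((invmx K *m q b) (enum_val t) 0 * (invmx K *m q b) (enum_val s) 0)) ->
  (\dim (Yspace R T S :&: congr_space K (rank1_perp q)) + \rank J)%N =
    \dim (SP R T S).
Proof.
move=> Ku KT JE; pose f := linfun (sym_embed (R := R) (T := T) (S := S)).
have JP b : vec_mx (row b J) \in SP R T S.
  apply/mem_SP => r c; rewrite !mxE !JE !enum_val_tau !enum_val_sigma.
  by rewrite mulrC.
rewrite -(dim_orthogonal_rows JP); congr addn.
set g := linfun _; rewrite -(dim_sym_embed (capvSl _ (lker g))) -/f.
have gE Y b : g Y 0 b =
    - ((invmx K *m q b)^T *m sym_embed Y *m (invmx K *m q b)) 0 0.
  rewrite quad_sym_embed lfunE /= mxE (reindex _ (curry_mxvec_bij _ _)) /=.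
  rewrite pair_bigA -sumrN; apply: eq_bigr => -[t s] _ /=.
  by rewrite mxvecE mxE JE mulrN.
have gP Y : Y \in lker g <->
    sym_embed Y \in congr_space K (rank1_perp q).
  rewrite mem_congr_perp //; last first.
    by rewrite /sym_embed linearZ linearD /= trmxK addrC.
  rewrite memv_ker; split=> [/eqP/rowP g0 b | Y0].
    by have := g0 b; rewrite gE [RHS]mxE => /eqP; rewrite oppr_eq0 => /eqP.
  by apply/eqP/rowP => b; rewrite gE Y0 oppr0 [RHS]mxE.
congr (\dim _); apply/vspaceP => M; apply/idP/memv_imgP.
  rewrite memv_cap => /andP[/memv_imgP[Y YP ->]]; rewrite lfunE /= => /gP YK.
  by exists Y; rewrite ?lfunE // memv_cap YP.
case=> Y YPg ->; move: YPg; rewrite !memv_cap => /andP[YP /gP YK].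
by rewrite memv_img // lfunE.
Qed.

End Block.

(** * Differentiation of the matrix inverse *)

(** Near 0 both functions have the same remainder, so the differential of [f] also serves for
    [g]. *)
Lemma near_eq_differentiable (F : numFieldType) (V W : normedModType F)
    (f g : V -> W) (x : V) :
  {near x, f =1 g} -> differentiable f x -> differentiable g x.
Proof.
move=> fg df; have fgx : f x = g x := nbhs_singleton fg.
have Eg : g \o shift x = cst (g x) + 'd f x +o_ 0 id.
  apply/eqaddoP => _/posnumP[e].
  have /eqaddoP/(_ e%:num)/(_ [gt0 of e%:num]) := diff_locally df.
  have : \forall y \near (0 : V), f (y + x) = g (y + x).
    by have := near_shift 0 x (fun y => f y = g y); rewrite subr0 => <-.
  apply: filterS2 => y /= fgy.
  suff -> : (f \o shift x - (cst (f x) + 'd f x)) y =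
            (g \o shift x - (cst (g x) + 'd f x)) y by [].
  by rewrite -fgx; congr (_ - _).
have df_cont := diff_continuous df.
by apply: (diff_locallyP x g).2; rewrite (diff_unique df_cont Eg).
Qed.

Lemma derive_coord (R : realType) m n (i : 'I_m) (j : 'I_n)
    (M v : 'M[R]_(m, n)) :
  'D_v (fun A : 'M[R]_(m, n) => A i j : R) M = v i j.
Proof.
have := derive_mx (@derivable_id R _ M v).
by rewrite derive_id => /matrixP/(_ i j); rewrite mxE.
Qed.

Section Inverse.
Variables (R : realType) (V : normedModType R).

Lemma differentiable_bigprod n (f : 'I_n -> V -> R) x :
  (forall i, differentiable (f i) x) ->
  differentiable (fun y => \prod_i f i y) x.
Proof.
move=> df; rewrite (_ : (fun _ => _) = \prod_i f i); last first.
  by apply/funext => y; elim/big_ind2: _ => // a ? b ? -> ->.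
elim/big_ind: _ => //.
by move=> g h dg dh; apply: differentiableM.
Qed.

Lemma differentiable_bigsum (I : finType) (P : pred I) (f : I -> V -> R) x :
  (forall i, differentiable (f i) x) ->
  differentiable (fun y => \sum_(i | P i) f i y) x.
Proof.
move=> df; rewrite (_ : (fun _ => _) = \sum_(i | P i) f i); last first.
  by apply/funext => y; elim/big_ind2: _ => // a ? b ? -> ->.
elim/big_ind: _ => //.
by move=> g h dg dh; apply: differentiableD.
Qed.

Lemma differentiable_det n (A : V -> 'M[R]_n) x :
  (forall i j, differentiable (fun y => A y i j : R) x) ->
  differentiable (fun y => \det (A y) : R) x.
Proof.
move=> dA; apply: differentiable_bigsum => s0; pose s : {perm 'I_n} := s0.
apply: (@differentiableZ R V R^o (fun y => \prod_i A y i (s i)) ((-1) ^+ s)).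
exact: differentiable_bigprod.
Qed.

Lemma near_unitmx n (A : V -> 'M[R]_n) x :
  (forall i j, differentiable (fun y => A y i j : R) x) ->
  A x \in unitmx -> \forall y \near x, A y \in unitmx.
Proof.
move=> dA; rewrite unitmxE unitfE => detA0.
have cont_det := differentiable_continuous (differentiable_det dA).
apply: filterS (cvgr_neq0 _ cont_det detA0) => y detAy.
by rewrite unitmxE unitfE.
Qed.

Lemma differentiable_invmx n (A : V -> 'M[R]_n) x :
  (forall i j, differentiable (fun y => A y i j : R) x) ->
  A x \in unitmx ->
  forall i j, differentiable (fun y => invmx (A y) i j : R) x.
Proof.
move=> dA Ax i j; have ddet := differentiable_det dA.
(* Cramer's rule describes [invmx] only on invertible matrices, since [invmx] returns any other
   matrix unchanged; agreement near [x] is enough. *)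
apply: (@near_eq_differentiable _ _ _
  (fun y => (\det (A y))^-1 * cofactor (A y) j i)).
  by apply: filterS (near_unitmx dA Ax) => y Ay; rewrite /invmx Ay !mxE.
apply: (differentiableM (f := fun y => (\det (A y))^-1)).
  by apply: differentiableV => //; rewrite -unitfE -unitmxE.
apply: (@differentiableZ R V R^o (fun y => \det (row' j (col' i (A y))))
  ((-1) ^+ (j + i))).
by apply: differentiable_det => r c; under eq_fun do rewrite !mxE.
Qed.

Lemma derive_invmx n (A : V -> 'M[R]_n) x v :
  (forall i j, differentiable (fun y => A y i j : R) x) ->
  A x \in unitmx ->
  \matrix_(i, j) 'D_v (fun y => invmx (A y) i j : R) x =
  - (invmx (A x) *m (\matrix_(i, j) 'D_v (fun y => A y i j : R) x) *m
     invmx (A x)).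
Proof.
(* Differentiate [A y *m invmx (A y) = 1%:M], valid near [x], entrywise. *)
move=> dA Ax; set DC := (\matrix_(i, j) _); set DA := (\matrix_(i, j) _).
have dC := differentiable_invmx dA Ax.
(* Multiplying this product rule on the left by [invmx (A x)] isolates [DC]. *)
suff AC0 : A x *m DC + DA *m invmx (A x) = 0.
  apply/eqP; rewrite -mulmxA -addr_eq0 -[X in X + _](mulKmx Ax) -mulmxDr.
  by rewrite AC0 mulmx0.
apply/matrixP => i j; rewrite [RHS]mxE.
pose F l : V -> R := (fun y => A y i l) * (fun y => invmx (A y) l j).
have dF l : derivable (F l) x v.
  by apply: derivableM; apply: diff_derivable.
have -> : 0 = 'D_v (cst ((1%:M : 'M[R]_n) i j)) x :> R by rewrite derive_cst.
have -> : 'D_v (cst ((1%:M : 'M[R]_n) i j)) x = 'D_v (\sum_l F l) x.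
  apply: near_eq_derive.
  apply: filterS (near_unitmx dA Ax) => y Ay /=.
  by rewrite fct_sumE -(mulmxV Ay) mxE.
rewrite derive_sum // !mxE -big_split; apply: eq_bigr => l _ /=.
rewrite deriveM; [|exact: diff_derivable|exact: diff_derivable].
by rewrite !mxE [in RHS]/GRing.scale /= [X in _ + X]mulrC.
Qed.

End Inverse.

(** * The Jacobian of the response *)

Section Network.
Variables (R : realType) (N nb : nat) (G : network R N nb).

Lemma KffE (a k : 'rV[R]_nb) i j :
  Kff G a k i j = \sum_b (k 0 b * q G b i 0 + a 0 b * sfull G b (free_dof i) 0)
    * q G b j 0.
Proof.
rewrite /Kff mxE /Kfull summxE; apply: eq_bigr => b _.
by rewrite mxE big_ord1 !mxE.
Qed.

Lemma differentiable_Kff (a k : 'rV[R]_nb) i j :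
  differentiable (fun k' => Kff G a k' i j : R) k.
Proof.
under eq_fun do rewrite KffE.
apply: differentiable_bigsum => b.
apply: differentiableM; last exact: differentiable_cst.
apply: differentiableD; last exact: differentiable_cst.
apply: differentiableM; last exact: differentiable_cst.
exact: differentiable_coord.
Qed.

Lemma derive_Kff (a k v : 'rV[R]_nb) i j :
  'D_v (fun k' => Kff G a k' i j : R) k =
  \sum_b v 0 b * (q G b i 0 * q G b j 0).
Proof.
pose c b : R := q G b i 0 * q G b j 0.
pose F b : 'rV[R]_nb -> R := c b *: (fun k' : 'rV[R]_nb => k' 0 b : R).
have dcoord b : derivable (fun k' : 'rV[R]_nb => k' 0 b : R) k v.
  by apply: diff_derivable; exact: differentiable_coord.
have dF b : derivable (F b) k v by apply: derivableZ.
(* [Kff] is affine in the stiffnesses: the odd couplings sit in the constant term, so the derivative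
   sees only the symmetric [q q^T] terms. *)
have -> : (fun k' => Kff G a k' i j : R) = cst (Kff G a 0 i j) + \sum_b F b.
  apply/funext => k'.
  apply: (@etrans _ _ (Kff G a 0 i j + (\sum_b F b) k')) => [|//].
  rewrite !KffE fct_sumE -big_split.
  apply: eq_bigr => b _; rewrite -[F b k']/(c b * k' 0 b).
  rewrite [(0 : 'rV_nb) 0 b]mxE mul0r add0r mulrDl addrC.
  by rewrite [c b * _]mulrC -!mulrA.
rewrite deriveD; [|exact: derivable_cst|exact: derivable_sum].
rewrite derive_cst add0r derive_sum //; apply: eq_bigr => b _.
by rewrite deriveZ // derive_coord mulrC.
Qed.

Lemma dresponseE (a k : 'rV[R]_nb) (T S : {set 'I_(nfree G)}) b t s :
  Kff G a k \in unitmx -> (Kff G a k)^T = Kff G a k ->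
  dresponse a T S k b (mxvec_index t s) =
  - ((invmx (Kff G a k) *m q G b) (enum_val t) 0 *
     (invmx (Kff G a k) *m q G b) (enum_val s) 0).
Proof.
move=> Ku KT; pose f k' := mxvec (response a T S k').
have dK := differentiable_Kff a k.
have df : differentiable f k.
  rewrite (_ : f = \sum_l (fun k' => f k' 0 l *: delta_mx 0 l)); last first.
    by apply/funext => k'; rewrite fct_sumE -row_sum_delta.
  apply: differentiable_sum => l; apply: differentiableZl.
  case/mxvec_indexP: l => t' s'; rewrite /f.
  under eq_fun do rewrite mxvecE mxE.
  exact: differentiable_invmx.
(* Row [b] of the Jacobian is the derivative along the [b]-th basis vector. *)
have -> : dresponse a T S k b (mxvec_index t s) =
          ('D_(delta_mx 0 b) f k) 0 (mxvec_index t s).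
  by rewrite deriveEjacobian // -rowE [RHS]mxE.
have fE (k' : 'rV_nb) : f k' 0 (mxvec_index t s) =
    invmx (Kff G a k') (enum_val t) (enum_val s).
  by rewrite mxvecE mxE.
have /matrixP-> := derive_mx (diff_derivable (v := delta_mx 0 b) df).
rewrite mxE.
under eq_fun do rewrite fE.
have := derive_invmx (delta_mx 0 b) dK Ku.
move=> /matrixP/(_ (enum_val t) (enum_val s)); rewrite mxE => ->.
have -> : (\matrix_(i, j) 'D_(delta_mx 0 b) (fun k' => Kff G a k' i j : R) k) =
          q G b *m (q G b)^T.
  apply/matrixP => i j; rewrite mxE derive_Kff (bigD1 b) //= big1 ?addr0.
    rewrite [delta_mx _ _ _ _]mxE !eqxx mul1r [RHS]mxE big_ord1.
    by rewrite [X in _ = _ * X]mxE.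
  by move=> b' /negPf b'b; rewrite [delta_mx _ _ _ _]mxE eqxx /= b'b mul0r.
rewrite mxE mulmxA -mulmxA; congr (- _).
(* Symmetry at [k] makes the left and right factors of the rank-one derivative the same vector. *)
have -> : (q G b)^T *m invmx (Kff G a k) = (invmx (Kff G a k) *m q G b)^T.
  by rewrite trmx_mul trmx_inv KT.
by rewrite mxE big_ord1 [X in _ * X]mxE.
Qed.

End Network.

Theorem theorem13 (R : realType) (N nb : nat) (G : network R N nb)
    (a : 'rV[R]_nb) (T S : {set 'I_(nfree G)}) (k : 'rV[R]_nb) :
  admissible G a k ->
  (Kff G a k)^T = Kff G a k ->
  let p := #|T :&: S| in
  let d := (#|T| * #|S| - (p * (p - 1)) %/ 2)%N in
  \dim (Yspace R T S) = d /\
  d%:Z - (\rank (dresponse a T S k))%:Z =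
    (\dim (Yspace R T S :&:
           congr_space (Kff G a k) (rank1_perp (q G))))%:Z.
Proof.
move=> [_ Ku] KT p d.
(* The natural-number subtraction in [d] does not truncate: [p] is at most [#|T|] and [p - 1] at
   most [#|S|]. *)
have dE : (d + 'C(p, 2))%N = (#|T| * #|S|)%N.
  rewrite /d subn1 divn2 -bin2 subnK // bin2 leq_half_double.
  apply: leqW; rewrite -addnn; apply: leq_trans (leq_addr _ _).
  apply: leq_mul; first exact: subset_leq_card (subsetIl T S).
  apply: leq_trans (leq_pred _) _; exact: subset_leq_card (subsetIr T S).
have dimSP : \dim (SP R T S) = d.
  by apply/eqP; rewrite -(eqn_add2r 'C(p, 2)) dim_SP dE.
split; first by rewrite /Yspace dim_sym_embed.
have := dim_Yspace_cap_congr (J := dresponse a T S k) Ku KT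
  (fun b t s => dresponseE b t s Ku KT).
by rewrite dimSP => <-; rewrite PoszD addrK.
Qed.
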